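(* Let $\mathcal C\subseteq\mathbb{F}_q^n$ be a nonempty $q$-ary constant-weight code of length $n$ and constant weight $w$, with $M=|\mathcal C|$ and distance distribution $\{B_i\}_{i=0}^n$. Then for each $k=1,2,\dots,n$, $$\sum_{i=1}^n P_k(n;i)B_i\ \ge\ (M-1)(q-1)^k\binom{n}{k}-\frac{2q}{(q-1)M}T(k),$$ where $T(k)=T_1(k)+T_2(k)+T_3(k)$ as defined in the context.
   Context: $\mathbb{F}_q$ is a finite field with $q$ elements. A constant-weight code of length $n$ and weight $w$ is a subset of $\mathbb{F}_q^n$ all of whose elements have exactly $w$ nonzero coordinates. The Hamming distance $d(u,v)$ is the number of coordinates where $u,v$ differ; the distance distribution is $B_i=\frac{1}{|\mathcal C|}|\{(u,v):u,v\in\mathcal C,\ d(u,v)=i\}|$. The Krawtchouk polynomial is $P_k(n;x)=\sum_{j=0}^k(-1)^j(q-1)^{k-j}\binom{x}{j}\binom{n-x}{k-j}$, and $P_k^-(n;x)=\frac12\sum_{j=0}^k\left[(q-1)^j-(-1)^j\right](q-1)^{k-j}\binom{x}{j}\binom{n-x}{k-j}$. Let $q_k,r_k$ be the quotient and remainder when dividing the integer $\frac{2(q-1)M}{q}P_k^-(n;w)$ by $(q-1)^k\binom{n}{k}$; let $s_k,t_k$ be the quotient and remainder when dividing $q_k$ by $q-1$; let $s'_k,t'_k$ be the quotient and remainder when dividing $q_k+1$ by $q-1$. Define $$T_1(k)=\left[(q-1)^k\binom{n}{k}-r_k\right](M-q_k)q_k+r_k(M-q_k-1)(q_k+1),$$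 $$T_2(k)=\left[(q-1)^k\binom{n}{k}-r_k\right]\left[\binom{q-1-t_k}{2}s_k^2+(q-1-t_k)t_ks_k(s_k+1)+\binom{t_k}{2}(s_k+1)^2\right],$$ $$T_3(k)=r_k\left[\binom{q-1-t'_k}{2}s_k'^2+(q-1-t'_k)t'_ks'_k(s'_k+1)+\binom{t'_k}{2}(s'_k+1)^2\right].$$ *)

(* Defs.v *)
From mathcomp Require Import all_boot all_order all_algebra.
From mathcomp Require Import ring.

Set Implicit Arguments.
Unset Strict Implicit.
Unset Printing Implicit Defensive.

Import Order.TTheory GRing.Theory Num.Theory.
Local Open Scope ring_scope.

Section Codes.

Variables (F : finFieldType) (n : nat).

Definition hamming_weight (u : 'rV[F]_n) : nat := #|[set i | u 0 i != 0]|.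

Definition hamming_dist (u v : 'rV[F]_n) : nat :=
  #|[set i | u 0 i != v 0 i]|.

Definition constant_weight_code (w : nat) (C : {set 'rV[F]_n}) : Prop :=
  forall u, u \in C -> hamming_weight u = w.

Definition distance_distribution (C : {set 'rV[F]_n}) (i : nat) : rat :=
  #|[set p : 'rV[F]_n * 'rV[F]_n |
       [&& p.1 \in C, p.2 \in C & hamming_dist p.1 p.2 == i]]|%:R / #|C|%:R.

End Codes.

(* Values at integer points: [n - x] is truncated subtraction, so these are the
   Krawtchouk polynomials P_k(n;x) and P_k^-(n;x) only for [x <= n]. *)
Definition krawtchouk (q n k x : nat) : rat :=
  \sum_(j < k.+1)
     (-1) ^+ j * (q%:R - 1) ^+ (k - j) * 'C(x, j)%:R * 'C(n - x, k - j)%:R.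

Definition krawtchouk_minus (q n k x : nat) : rat :=
  2^-1 * \sum_(j < k.+1)
     ((q%:R - 1) ^+ j - (-1) ^+ j) * (q%:R - 1) ^+ (k - j)
       * 'C(x, j)%:R * 'C(n - x, k - j)%:R.

Section Bound.

Variables q n w M k : nat.

Definition dividend_rat : rat :=
  2 * (q%:R - 1) * M%:R / q%:R * krawtchouk_minus q n k w.

(* No rounding takes place in [truncn]: see [dividendE]. *)
Definition dividend : nat := Num.truncn dividend_rat.

Definition num_words : nat := ((q - 1) ^ k * 'C(n, k))%N.

Definition qk : nat := (dividend %/ num_words)%N.
Definition rk : nat := (dividend %% num_words)%N.
Definition sk : nat := (qk %/ (q - 1))%N.
Definition tk : nat := (qk %% (q - 1))%N.
Definition sk' : nat := (qk.+1 %/ (q - 1))%N.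
Definition tk' : nat := (qk.+1 %% (q - 1))%N.

Definition T1 : rat :=
  (num_words%:R - rk%:R) * (M%:R - qk%:R) * qk%:R
  + rk%:R * (M%:R - qk%:R - 1) * (qk%:R + 1).

(* The bracket shared by T_2 and T_3. The subtraction [q - 1 - t] is exact for
   [t < q - 1]. *)
Definition pair_sum (s t : nat) : rat :=
  'C(q - 1 - t, 2)%:R * s%:R ^+ 2
  + (q - 1 - t)%:R * t%:R * s%:R * (s%:R + 1)
  + 'C(t, 2)%:R * (s%:R + 1) ^+ 2.

Definition T2 : rat := (num_words%:R - rk%:R) * pair_sum sk tk.
Definition T3 : rat := rk%:R * pair_sum sk' tk'.

Definition Tsum : rat := T1 + T2 + T3.

Lemma dividendE : (1 < q)%N -> dividend%:R = dividend_rat.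
Proof.
move=> q_gt1; apply: truncnK.
have q0 : q%:R != 0 :> rat by rewrite pnatr_eq0 -lt0n ltnW.
pose Q : rat := q%:R - 1.
have QE : Q = (q - 1)%:R by rewrite natrB // ltnW.
have Q1 : 1 <= Q by rewrite QE ler1n subn_gt0.
have Qnat : Q \is a Num.nat by rewrite QE natr_nat.
have key j : (Q ^+ j - (-1) ^+ j) / q%:R \is a Num.nat.
  rewrite natrEint; apply/andP; split.
    elim: j => [|j IHj]; first by rewrite subrr mul0r rpred0.
    have -> : (Q ^+ j.+1 - (-1) ^+ j.+1) / q%:R
        = Q * ((Q ^+ j - (-1) ^+ j) / q%:R) + (-1) ^+ j.
      by rewrite !exprS /Q; field.
    apply: rpredD; last by rewrite rpredX ?rpredN ?rpred1.
    by apply: rpredM => //; rewrite QE intr_nat.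
  apply: divr_ge0 => //; rewrite subr_ge0; apply: (@le_trans _ _ 1).
    by rewrite -signr_odd; case: (odd j).
  exact: exprn_ege1.
rewrite /dividend_rat /krawtchouk_minus -/Q.
have -> : 2 * Q * M%:R / q%:R * (2^-1 * \sum_(j < k.+1)
     (Q ^+ j - (-1) ^+ j) * Q ^+ (k - j) * 'C(w, j)%:R * 'C(n - w, k - j)%:R)
  = Q * M%:R * \sum_(j < k.+1) (Q ^+ j - (-1) ^+ j) / q%:R * Q ^+ (k - j)
       * 'C(w, j)%:R * 'C(n - w, k - j)%:R.
  rewrite !mulr_sumr; apply: eq_bigr => j _.
  by field.
apply: rpredM; first by apply: rpredM => //; apply: natr_nat.
apply: rpred_sum => j _.
apply: rpredM (natr_nat _ _); apply: rpredM (natr_nat _ _).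
by apply: rpredM (key j) (rpredX _ Qnat).
Qed.

End Bound.

(* Main.v *)
(* For a word [a] of weight k let m_c be the number of codewords u with
   <u, a> = c. The words of weight k orthogonal to a given vector are counted
   by a Krawtchouk value, so the left-hand side of the theorem is an affine
   function of the sum over [a] of the collision numbers sum_c m_c^2, and the
   number x = M - m_0 of codewords with <u, a> != 0 sums over [a] to
   [dividend]. For fixed x, sum_c m_c^2 is least when the m_c with c != 0 are as
   equal as possible; the resulting bound is convex in x, so its sum over [a]
   is least when the x are as equal as possible. *)
Require Import Defs.
From mathcomp Require Import all_boot all_order all_algebra.
From mathcomp Require Import ring lra.

Set Implicit Arguments.
Unset Strict Implicit.
Unset Printing Implicit Defensive.

Import Order.TTheory GRing.Theory Num.Theory.
Local Open Scope ring_scope.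

(** * Weight enumerator of the solutions of [dotp u a = c] *)

Definition dotp (F : finFieldType) (n : nat) (u a : 'rV[F]_n) : F :=
  \sum_i u 0 i * a 0 i.

Lemma big_row_recl (F : finFieldType) (V : nmodType) (n : nat)
    (G : 'rV[F]_n.+1 -> V) :
  \sum_a G a = \sum_(x : F) \sum_(b : 'rV[F]_n) G (row_mx x%:M b).
Proof.
rewrite pair_bigA /=.
rewrite (reindex (fun p : F * 'rV[F]_n => row_mx p.1%:M p.2 : 'rV[F]_n.+1)) //=.
exists (fun a : 'rV[F]_(1 + n) => (lsubmx a 0 0, rsubmx a)) => [[x b] _|a _] /=.
  by rewrite row_mxKl row_mxKr !mxE eqxx mulr1n.
by rewrite -mx11_scalar hsubmxK.
Qed.

Lemma dotp_row (F : finFieldType) (n : nat) (u0 x : F) (u b : 'rV[F]_n) :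
  @dotp F (1 + n) (row_mx u0%:M u) (row_mx x%:M b) = u0 * x + dotp u b.
Proof.
rewrite /dotp (@big_split_ord _ _ _ 1 n) big_ord1 /=.
rewrite !row_mxEl !mxE eqxx !mulr1n; congr (_ + _).
by apply: eq_bigr => i _; rewrite !row_mxEr.
Qed.

Lemma hamming_weightE (F : finFieldType) (n : nat) (u : 'rV[F]_n) :
  hamming_weight u = (\sum_i (u ord0 i != 0%R))%N.
Proof.
rewrite /hamming_weight -sum1_card big_mkcond /=.
by apply: eq_bigr => i _; rewrite inE; case: (_ != _).
Qed.

Lemma hamming_weight_row (F : finFieldType) (n : nat) (x : F) (b : 'rV[F]_n) :
  hamming_weight (row_mx x%:M b : 'rV_(1 + n)) = ((x != 0%R) + hamming_weight b)%N.
Proof.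
rewrite !hamming_weightE (@big_split_ord _ _ _ 1 n) big_ord1 /=.
rewrite !row_mxEl !mxE eqxx !mulr1n; congr (_ + _)%N.
by apply: eq_bigr => i _; rewrite !row_mxEr.
Qed.

Lemma hamming_weight_le (F : finFieldType) (n : nat) (u : 'rV[F]_n) :
  (hamming_weight u <= n)%N.
Proof. by rewrite -[leqRHS]card_ord max_card. Qed.

Lemma sum_nonzero (F : finFieldType) :
  \sum_(x : F | x != 0) (1 : rat) = #|F|%:R - 1.
Proof.
by rewrite -sum1_card natr_sum [in RHS](bigD1 0) //= [RHS]addrC addKr.
Qed.

(* Character-free form of MacWilliams for a single word: by induction on [n],
   where the first coordinate contributes the factor [1 + (q-1)X] or [1 - X]
   to the part that depends on [c], according as it vanishes or not. *)
Lemma weight_enumerator_hyperplane (F : finFieldType) (n : nat)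
    (u : 'rV[F]_n) (c : F) :
  #|F|%:R *: \sum_(a | dotp u a == c) 'X^(hamming_weight a)
  = (1 + (#|F|%:R - 1) *: 'X) ^+ n
    + (#|F|%:R * (c == 0)%:R - 1) *: ((1 - 'X) ^+ hamming_weight u
        * (1 + (#|F|%:R - 1) *: 'X) ^+ (n - hamming_weight u)) :> {poly rat}.
Proof.
elim: n u c => [|n IHn] u c.
  have u0 : hamming_weight u = 0%N by rewrite hamming_weightE big_ord0.
  rewrite u0 !expr0 mulr1 big_mkcond /= (big_pred1 0); last first.
    by move=> a; apply/esym/eqP/matrixP=> i [].
  rewrite /dotp big_ord0 hamming_weightE big_ord0 expr0 eq_sym.
  case: eqP => _ /=; first by rewrite mulr1 scalerBl scale1r addrC subrK.
  by rewrite mulr0 sub0r scaler0 scaleN1r subrr.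
pose u0 : F := lsubmx (u : 'rV_(1 + n)) 0 0.
pose u' : 'rV[F]_n := rsubmx (u : 'rV_(1 + n)).
have -> : u = row_mx u0%:M u' by rewrite /u0 -mx11_scalar hsubmxK.
rewrite big_mkcond big_row_recl hamming_weight_row /=.
set q : rat := #|F|%:R; set A := 1 + _ *: 'X; set h := hamming_weight u'.
have hn : (h <= n)%N := hamming_weight_le u'.
(* Once the first coordinate [x] of the word is fixed, the rest [b] satisfies
   [dotp u' b = c - u0 * x], and the induction hypothesis applies with this constant. *)
transitivity (\sum_(x : F) 'X^(x != 0) * (A ^+ n +
   (q * (c - u0 * x == 0)%:R - 1) *: ((1 - 'X) ^+ h * A ^+ (n - h)))).
  rewrite scaler_sumr; apply: eq_bigr => x _.
  rewrite -IHn -scalerAr mulr_sumr -big_mkcond /=; congr (_ *: _).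
  apply: eq_big => [b|b _]; first by rewrite dotp_row [RHS]eq_sym subr_eq eq_sym addrC.
  by rewrite hamming_weight_row exprD.
rewrite (bigD1 0) //= eqxx expr0 mul1r mulr0 subr0.
set B := _ * A ^+ (n - h).
transitivity (A ^+ n + (q * (c == 0)%:R - 1) *: B + 'X *
   ((q - 1) *: A ^+ n
      + (\sum_(x : F | x != 0) (q * (c - u0 * x == 0)%:R - 1)) *: B)).
  congr (_ + _); rewrite -sum_nonzero !scaler_suml -big_split /= mulr_sumr.
  by apply: eq_bigr => x ->; rewrite scale1r expr1.
rewrite big_split /= sumrN sum_nonzero -mulr_sumr -/q.
have [u00|u0n] := eqVneq u0 0.
  rewrite /= add0n subSn // !exprS.
  have -> : \sum_(x : F | x != 0) (c - u0 * x == 0)%:R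
      = (c == 0)%:R * (q - 1) :> rat.
    rewrite -sum_nonzero mulr_sumr.
    by apply: eq_bigr => x _; rewrite u00 mul0r subr0 mulr1.
  have -> : (1 - 'X) ^+ h * (A * A ^+ (n - h)) = A * B by rewrite mulrCA.
  rewrite /A -!mul_polyC !(polyCB, polyCM, polyCD); ring.
rewrite /= add1n subSS !exprS -mulrA -/B.
(* The only root [x = c / u0] is excluded from the sum exactly when [c = 0]. The coefficient of [B]
   then factors as [(q * (c == 0) - 1) * (1 - 'X)]. *)
have -> : \sum_(x : F | x != 0) (c - u0 * x == 0)%:R = 1 - (c == 0)%:R :> rat.
  apply/eqP; rewrite -subr_eq opprK; apply/eqP.
  transitivity (\sum_(x : F) (c - u0 * x == 0)%:R : rat).
    by rewrite [RHS](bigD1 0) //= mulr0 subr0 addrC.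
  rewrite (bigD1 (c / u0)) //= mulrCA divff // mulr1 subrr eqxx.
  rewrite big1 ?addr0 // => x xc; rewrite subr_eq0; case: eqP => // cx.
  by move: xc; rewrite cx mulrC mulKf // eqxx.
rewrite /A -!mul_polyC !(polyCB, polyCM, polyCD); ring.
Qed.

(** The Cauchy product of the two binomial expansions is the Krawtchouk sum; this turns weight
    enumerators into counts. *)
Lemma coef_krawtchouk (q n k x : nat) :
  ((1 - 'X) ^+ x * (1 + (q%:R - 1) *: 'X) ^+ (n - x))`_k = krawtchouk q n k x.
Proof.
have E (c : rat) m i : ((1 + c *: 'X) ^+ m)`_i = c ^+ i * 'C(m, i)%:R.
  rewrite addrC exprDn coef_sum.
  transitivity (\sum_(j < m.+1) if i == (m - j)%N then c ^+ i * 'C(m, i)%:R else 0).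
    apply: eq_bigr => j _; rewrite expr1n mulr1 exprZn coefMn coefZ coefXn.
    case: eqP => [->|_]; last by rewrite mulr0 mul0rn.
    by rewrite mulr1 bin_sub ?leq_ord // mulr_natr.
  case: (leqP i m) => im.
    have jP : (m - i < m.+1)%N by rewrite ltnS leq_subr.
    rewrite (bigD1 (Ordinal jP)) //= subKn // eqxx big1 ?addr0 // => j.
    rewrite -val_eqE /= => ji; case: eqP => // ij; case/eqP: ji.
    by rewrite ij subKn // -ltnS.
  rewrite bin_small // mulr0 big1 // => j _; by case: ifP.
rewrite coefM /krawtchouk; apply: eq_bigr => j _.
rewrite E -scaleN1r E; ring.
Qed.

(** * Counting words of weight [k] by Krawtchouk values *)

Section Sphere.

Variables (F : finFieldType) (n k : nat).
Let q : rat := #|F|%:R.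
Let N : rat := (num_words #|F| n k)%:R.

Lemma num_wordsE : N = (q - 1) ^+ k * 'C(n, k)%:R.
Proof.
by rewrite /N /num_words natrM natrX natrB // ltnW // card_finNzRing_gt1.
Qed.

Lemma krawtchouk0 : krawtchouk #|F| n k 0 = N.
Proof.
rewrite /krawtchouk big_ord_recl /= big1 ?addr0 => [|i _]; last first.
  by rewrite bin0n mulr0 mul0r.
by rewrite bin0 expr0 mul1r mulr1 !subn0 num_wordsE.
Qed.

Lemma count_dotp_eq0 (u : 'rV[F]_n) :
  q * \sum_(a : 'rV[F]_n | hamming_weight a == k) (dotp u a == 0)%:R
  = N + (q - 1) * krawtchouk #|F| n k (hamming_weight u).
Proof.
have /(congr1 (fun p : {poly rat} => p`_k)) :=
  weight_enumerator_hyperplane u 0.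
rewrite eqxx mulr1 coefZ coefD coefZ coef_krawtchouk -/q.
have -> : ((1 + (q - 1) *: 'X) ^+ n)`_k = N.
  by have := coef_krawtchouk #|F| n k 0; rewrite expr0 mul1r subn0 krawtchouk0.
move=> <-; congr (_ * _); rewrite coef_sum big_mkcond [RHS]big_mkcond /=.
apply: eq_bigr => a _; rewrite coefXn eq_sym.
by do 2!case: eqP.
Qed.

(** Every word is orthogonal to [0], so [count_dotp_eq0] at [0] counts the whole sphere: [q] times
    its size is [N + (q - 1) * N]. *)
Lemma card_sphere : \sum_(a : 'rV[F]_n | hamming_weight a == k) (1 : rat) = N.
Proof.
have q0 : q != 0 by rewrite pnatr_eq0 -lt0n ltnW // card_finNzRing_gt1.
apply: (mulfI q0).
have d0 (a : 'rV[F]_n) : dotp 0 a = 0.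
  by rewrite /dotp big1 // => i _; rewrite mxE mul0r.
have w0 : hamming_weight (0 : 'rV[F]_n) = 0%N.
  by rewrite hamming_weightE big1 // => i _; rewrite mxE eqxx.
have := count_dotp_eq0 0; under eq_bigr do rewrite d0 eqxx.
by move=> ->; rewrite w0 krawtchouk0; ring.
Qed.

(** The [(q - 1) ^+ j] half of the sum collapses by Vandermonde's convolution, as [w + (n - w) = n];
    the [(-1) ^+ j] half is the Krawtchouk value. *)
Lemma krawtchouk_minusE (w : nat) : (w <= n)%N ->
  2 * krawtchouk_minus #|F| n k w = N - krawtchouk #|F| n k w.
Proof.
move=> wn; rewrite /krawtchouk_minus mulrA divff // mul1r.
rewrite num_wordsE -{2}(subnKC wn) -binomial.Vandermonde natr_sum mulr_sumr.
rewrite -sumrB; apply: eq_bigr => j _.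
have -> : (q - 1) ^+ k = (q - 1) ^+ j * (q - 1) ^+ (k - j).
  by rewrite -exprD subnKC // -ltnS.
by rewrite natrM; ring.
Qed.

(** By constant weight, every codeword is non-orthogonal to the same number of words of weight [k],
    namely [(q - 1) / q * (N - P_k(n;w))]. *)
Lemma sum_dotp_neq0 (w : nat) (C : {set 'rV[F]_n}) :
    constant_weight_code w C -> (w <= n)%N ->
  \sum_(a : 'rV[F]_n | hamming_weight a == k)
     \sum_(u in C) (dotp u a != 0)%:R
  = (dividend #|F| n w #|C| k)%:R :> rat.
Proof.
move=> Cw wn; rewrite dividendE ?card_finNzRing_gt1 // /dividend_rat -/q exchange_big /=.
have q0 : q != 0 by rewrite pnatr_eq0 -lt0n ltnW // card_finNzRing_gt1.
transitivity (\sum_(u in C) (q - 1) / q * (2 * krawtchouk_minus #|F| n k w)).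
  apply: eq_bigr => u uC; rewrite krawtchouk_minusE //.
  have := count_dotp_eq0 u; rewrite Cw // => e.
  transitivity (N - \sum_(a : 'rV[F]_n | hamming_weight a == k)
                      (dotp u a == 0)%:R).
    rewrite -card_sphere -sumrB; apply: eq_bigr => a _.
    by case: eqP => _; rewrite ?subrr ?subr0.
  apply: (mulfI q0); rewrite mulrBr e; field; exact: q0.
rewrite sumr_const -mulr_natr; field; exact: q0.
Qed.

End Sphere.

(** * Secant bounds for collision numbers *)

(** [pair_sum] adds the products of sizes over unordered pairs of distinct classes, [t] of size
    [s + 1] and [q - 1 - t] of size [s]. Its double is the square of the total [x] minus the sum of
    squares, and [m ^+ 2 = (2 * s + 1) * m - s * (s + 1)] for both sizes. *)
Lemma pair_sumE (q s t : nat) : (t <= q - 1)%N ->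
  let x : rat := (s * (q - 1) + t)%:R in
  2 * pair_sum q s t
  = x ^+ 2 - (2 * s%:R + 1) * x + (q - 1)%:R * s%:R * (s%:R + 1).
Proof.
move=> tq /=; rewrite /pair_sum.
have [r ->] : exists r, (q - 1 = r + t)%N by exists (q - 1 - t)%N; rewrite subnK.
have bin2E m : 2 * 'C(m, 2)%:R = m%:R * (m%:R - 1) :> rat.
  elim: m => [|m IHm]; first by rewrite mul0r mulr0.
  by rewrite binS bin1 natrD mulrDr IHm -natr1; ring.
rewrite addnK natrD natrM natrD; apply/eqP; rewrite -subr_eq0; apply/eqP.
transitivity ((2 * 'C(r, 2)%:R - r%:R * (r%:R - 1)) * s%:R ^+ 2
  + (2 * 'C(t, 2)%:R - t%:R * (t%:R - 1)) * (s%:R + 1) ^+ 2 : rat); first by ring.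
by rewrite !bin2E !subrr !mul0r addr0.
Qed.

(* Twice [Tsum] is the value at the total [dividend] of the affine function
   interpolating the concave bound at [qk] and [qk + 1]. *)
Lemma Tsum_affine (q n w M k : nat) : (1 < q)%N ->
  let Q : rat := (qk q n w M k)%:R in
  let s : rat := (sk q n w M k)%:R in
  2 * Tsum q n w M k
  = (2 * M%:R - 2 * Q - 2 * s - 2) * (dividend q n w M k)%:R
    + (num_words q n k)%:R * (Q * (Q + 1) + (q%:R - 1) * s * (s + 1)).
Proof.
move=> q1 Q s; rewrite /Tsum /T1 /T2 /T3 -/Q.
have p0 : (0 < q - 1)%N by rewrite subn_gt0.
have pE : (q - 1)%:R = q%:R - 1 :> rat by rewrite natrB // ltnW.
have -> : ((dividend q n w M k)%:R : rat)
    = Q * (num_words q n k)%:R + (rk q n w M k)%:R.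
  by rewrite [in LHS](divn_eq (dividend q n w M k) (num_words q n k)) natrD natrM.
set t := tk q n w M k; set N : rat := (num_words q n k)%:R.
have QE : qk q n w M k = (sk q n w M k * (q - 1) + t)%N by exact: divn_eq.
have tp : (t < q - 1)%N by rewrite ltn_mod.
have e2 : 2 * pair_sum q (sk q n w M k) t
    = Q ^+ 2 - (2 * s + 1) * Q + (q%:R - 1) * s * (s + 1).
  by rewrite pair_sumE ?(ltnW tp) // -QE pE.
have e3 : 2 * pair_sum q (sk' q n w M k) (tk' q n w M k)
    = (Q + 1) ^+ 2 - (2 * s + 1) * (Q + 1) + (q%:R - 1) * s * (s + 1).
  have tp' : (tk' q n w M k <= q - 1)%N by rewrite ltnW // ltn_mod.
  rewrite pair_sumE // -divn_eq pE -natr1 -/Q.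
  have QE1 : (qk q n w M k).+1 = (sk q n w M k * (q - 1) + t.+1)%N.
    by rewrite addnS -QE.
  (* If [t + 1 = q - 1], the quotient jumps to [s + 1] with remainder 0. All classes then have size
     [s + 1], where the secants for [s] and for [s + 1] agree, so the formula in [s] persists. *)
  move: tp; rewrite leq_eqVlt => /orP[/eqP tE|tp]; last first.
    by rewrite /sk' QE1 divnMDl // (divn_small tp) addn0.
  have -> : sk' q n w M k = (sk q n w M k).+1.
    by rewrite /sk' QE1 tE divnMDl // divnn p0 addn1.
  have -> : Q + 1 = (s + 1) * (q%:R - 1).
    by rewrite natr1 QE1 tE natrD natrM pE; ring.
  rewrite -natr1 -/s; ring.
have -> (a b c d f : rat) : 2 * (a + b * c + d * f)
    = 2 * a + b * (2 * c) + d * (2 * f) by ring.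
rewrite e2 e3; ring.
Qed.

(** No integer lies strictly between [s] and [s + 1]. *)
Lemma consecutive_ge0 (m s : nat) :
  0 <= (m%:R - s%:R) * (m%:R - s%:R - 1) :> rat.
Proof.
case: (leqP m s) => [ms|sm].
  rewrite mulr_le0 // ?subr_le0 ?ler_nat //.
  by rewrite (@le_trans _ _ 0) // ?subr_le0 ?ler_nat // lerBlDr ltW // ltr_pwDr.
by apply: mulr_ge0; rewrite ?subr_ge0 ?ler_nat ?(ltnW sm) // lerBrDl natr1 ler_nat.
Qed.

(* Both quadratic terms, the square of the number [x] of nonzero values and
   the squares of the fibre sizes, are bounded below by their secants through
   consecutive integers. *)
Lemma collisions_ge (F : finFieldType) (T : finType) (C : {set T}) (f : T -> F)
    (s Q : nat) :
  #|C|%:R ^+ 2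
    - ((2 * #|C|%:R - 2 * Q%:R - 2 * s%:R - 2) * \sum_(u in C) (f u != 0)%:R
       + Q%:R * (Q%:R + 1) + (#|F|%:R - 1) * s%:R * (s%:R + 1))
  <= \sum_(u in C) \sum_(v in C) (f u == f v)%:R :> rat.
Proof.
set M : rat := #|C|%:R; set x : rat := \sum_(u in C) (f u != 0)%:R.
pose m c := (\sum_(u in C) (f u == c))%N.
have -> : \sum_(u in C) \sum_(v in C) (f u == f v)%:R
    = \sum_(c : F) (m c)%:R ^+ 2 :> rat.
  transitivity (\sum_(c : F) \sum_(u in C) \sum_(v in C)
                  (f u == c)%:R * (f v == c)%:R : rat).
    rewrite [RHS]exchange_big; apply: eq_bigr => u _ /=.
    rewrite [RHS]exchange_big; apply: eq_bigr => v _ /=.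
    rewrite (bigD1 (f u)) //= eqxx mul1r eq_sym big1 ?addr0 // => c cu.
    by rewrite eq_sym (negPf cu) mul0r.
  apply: eq_bigr => c _; rewrite /m expr2 natr_sum mulr_suml.
  by apply: eq_bigr => u _; rewrite mulr_sumr.
have mx : \sum_(c : F | c != 0) (m c)%:R = x.
  transitivity (\sum_(u in C) \sum_(c : F | c != 0) (f u == c)%:R : rat).
    by rewrite exchange_big; apply: eq_bigr => c _; rewrite /m natr_sum.
  apply: eq_bigr => u _; case: eqP => [fu|/eqP fu] /=.
    by apply: big1 => c; rewrite fu eq_sym => /negPf ->.
  rewrite (bigD1 (f u)) //= eqxx big1 ?addr0 // => c /andP[_].
  by rewrite eq_sym => /negPf ->.
have m0 : (m 0)%:R = M - x.
  rewrite /M /m -sum1_card !natr_sum -sumrB; apply: eq_bigr => u _.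
  by case: eqP => _; rewrite ?subr0 ?subrr.
pose X := (\sum_(u in C) (f u != 0%R))%N.
have xX : x = X%:R by rewrite /X natr_sum.
have := consecutive_ge0 X Q; rewrite -xX => xQ.
have ms : (2 * s%:R + 1) * x - (#|F|%:R - 1) * s%:R * (s%:R + 1)
    <= \sum_(c : F | c != 0) (m c)%:R ^+ 2.
  rewrite -mx -sum_nonzero -mulrA mulr_sumr mulr_suml -sumrB.
  apply: ler_sum => c _; have := consecutive_ge0 (m c) s; nra.
(* In [(M - x) ^+ 2], [xQ] bounds [x ^+ 2] below by [(2 * Q + 1) * x - Q * (Q + 1)]; [ms] bounds the
   remaining squares. *)
rewrite (bigD1 0) //= m0; nra.
Qed.

(** * From the distance distribution to collisions, and the final bound *)

Lemma dotpBl (F : finFieldType) (n : nat) (u v a : 'rV[F]_n) :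
  dotp (u - v) a = dotp u a - dotp v a.
Proof.
by rewrite /dotp -sumrB; apply: eq_bigr => i _; rewrite !mxE mulrBl.
Qed.

Lemma hamming_distE (F : finFieldType) (n : nat) (u v : 'rV[F]_n) :
  hamming_dist u v = hamming_weight (u - v).
Proof. by apply: eq_card => i; rewrite !inE !mxE subr_eq0. Qed.

(** Sorting pairs of codewords by distance gives the sum from [i = 0]. Only equal pairs have
    distance 0, so [B_0 = 1] and omitting that term costs [P 0]. *)
Lemma sum_distance_distribution (F : finFieldType) (n : nat)
    (C : {set 'rV[F]_n}) (P : nat -> rat) :
  C != set0 ->
  \sum_(1 <= i < n.+1) P i * distance_distribution C i
  = (\sum_(u in C) \sum_(v in C) P (hamming_weight (u - v))) / #|C|%:R - P 0%N.
Proof.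
move=> C0; have M0 : #|C|%:R != 0 :> rat by rewrite pnatr_eq0 cards_eq0.
have DE i : distance_distribution C i
    = (\sum_(u in C) \sum_(v in C) (hamming_weight (u - v) == i)%:R) / #|C|%:R.
  congr (_ / _); rewrite pair_big_dep /= -natr_sum -sum1_card; congr (_%:R).
  rewrite big_mkcond [RHS]big_mkcond /=; apply: eq_bigr => -[u v] _.
  rewrite inE /= hamming_distE.
  by case: (u \in C); case: (v \in C); case: eqP.
have D0 : distance_distribution C 0 = 1.
  rewrite DE -[RHS](divff M0); congr (_ / _); rewrite -sum1_card natr_sum.
  apply: eq_bigr => u uC; rewrite (bigD1 u) //= subrr big1.
    rewrite addr0; congr (_%:R); rewrite hamming_weightE big1 // => i _.
    by rewrite mxE eqxx.
  move=> v /andP[_ vu]; rewrite -hamming_distE cards_eq0.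
  case: eqP => // /setP e; case/eqP: vu; apply/rowP=> i.
  by have := e i; rewrite !inE => /negbFE/eqP.
have -> : \sum_(u in C) \sum_(v in C) P (hamming_weight (u - v))
    = \sum_(0 <= i < n.+1) P i
        * \sum_(u in C) \sum_(v in C) (hamming_weight (u - v) == i)%:R.
  under [RHS]eq_bigr do rewrite mulr_sumr; rewrite [RHS]exchange_big /=.
  apply: eq_bigr => u _.
  under [RHS]eq_bigr do rewrite mulr_sumr; rewrite [RHS]exchange_big /=.
  apply: eq_bigr => v _; rewrite big_mkord.
  have wn : (hamming_weight (u - v) < n.+1)%N by rewrite ltnS hamming_weight_le.
  rewrite (bigD1 (Ordinal wn)) //= eqxx mulr1 big1 ?addr0 // => i.
  by rewrite -val_eqE eq_sym /= => /negPf ->; rewrite mulr0.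
rewrite [in RHS]big_ltn // mulrDl -mulrA -DE D0 mulr1 [RHS]addrC addKr mulr_suml.
by apply: eq_bigr => i _; rewrite -mulrA -DE.
Qed.

Theorem theorem3p4 (F : finFieldType) (n w : nat) (C : {set 'rV[F]_n}) :
  C != set0 ->
  constant_weight_code w C ->
  forall k : nat, (1 <= k <= n)%N ->
    \sum_(1 <= i < n.+1) krawtchouk #|F| n k i * distance_distribution C i
    >= (#|C|%:R - 1) * (#|F|%:R - 1) ^+ k * 'C(n, k)%:R
       - 2 * #|F|%:R / ((#|F|%:R - 1) * #|C|%:R) * Tsum #|F| n w #|C| k.
Proof.
move=> C0 Cw k _.
have wn : (w <= n)%N.
  by have /set0Pn[u uC] := C0; rewrite -(Cw u uC) hamming_weight_le.
rewrite sum_distance_distribution // krawtchouk0 -mulrA -num_wordsE.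
set N : rat := _%:R; set K := \sum_(u in C) _; set M : rat := #|C|%:R.
set q : rat := #|F|%:R; set T := Tsum _ _ _ _ _.
have M0 : 0 < M by rewrite ltr0n card_gt0.
have q1 : 0 < q - 1 by rewrite subr_gt0 ltr1n card_finNzRing_gt1.
have q0 : 0 < q by rewrite (lt_trans ltr01) // -subr_gt0.
pose Z : rat := \sum_(a : 'rV[F]_n | hamming_weight a == k)
  \sum_(u in C) \sum_(v in C) (dotp u a == dotp v a)%:R.
(* A collision of [u] and [v] at [a] means that [a] is orthogonal to [u - v], which [count_dotp_eq0]
   counts. *)
have ZE : q * Z = M ^+ 2 * N + (q - 1) * K.
  rewrite /Z exchange_big /= mulr_sumr /K.
  transitivity (\sum_(u in C) \sum_(v in C)
     (N + (q - 1) * krawtchouk #|F| n k (hamming_weight (u - v)))).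
    apply: eq_bigr => u _; rewrite exchange_big /= mulr_sumr.
    apply: eq_bigr => v _; rewrite -count_dotp_eq0; congr (_ * _).
    by apply: eq_bigr => a _; rewrite dotpBl subr_eq0.
  under eq_bigr do rewrite big_split sumr_const -mulr_sumr -[N *+ _]mulr_natr.
  rewrite big_split sumr_const -mulr_sumr -[(N * _) *+ _]mulr_natr /= -/M; ring.
(* With [Q] and [s] the same for all [a], the bound of [collisions_ge] is affine in the number of
   nonzero products, so its sum over [a] depends only on their total [dividend]. *)
have ZT : M ^+ 2 * N - 2 * T <= Z.
  rewrite Tsum_affine ?card_finNzRing_gt1 // -sum_dotp_neq0 // -/M -/q -/N.
  set Q := qk _ _ _ _ _; set s := sk _ _ _ _ _.
  have := ler_sum (index_enum _) (fun (a : 'rV[F]_n) (_ : hamming_weight a == k) =>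
    collisions_ge C (fun u => dotp u a) s Q).
  apply: le_trans; rewrite le_eqVlt; apply/orP; left; apply/eqP.
  have cst (c : rat) :
      N * c = \sum_(a : 'rV[F]_n | hamming_weight a == k) c.
    by rewrite /N -card_sphere mulr_suml; apply: eq_bigr => a _; rewrite mul1r.
  rewrite [_ * N]mulrC !cst [in LHS]mulr_sumr -big_split -sumrB /=.
  by apply: eq_bigr => a _; rewrite addrA.
(* Both sides become the same increasing affine function, taken at [M ^+ 2 * N - 2 * T] and at
   [Z]. *)
have -> : (M - 1) * N - 2 * q / ((q - 1) * M) * T
    = (q * (M ^+ 2 * N - 2 * T) - M ^+ 2 * N) / ((q - 1) * M) - N.
  by field; rewrite !gt_eqF.
have -> : K / M = (q * Z - M ^+ 2 * N) / ((q - 1) * M).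
  by rewrite ZE; field; rewrite !gt_eqF.
rewrite lerD2r ler_pM2r ?invr_gt0 ?mulr_gt0 // lerD2r.
by rewrite ler_pM2l.
Qed.
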